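(* Let $K$ be a scattered locally compact Hausdorff space and let $X$ be a finite dimensional Banach space. Then (a) $C_0(K,X)$ has property CWO-$B$; (b) if $X$ has property (co), then $C_0(K,X)$ has property CWO.
   Context: Banach spaces are over the scalar field $\mathbb K$, where $\mathbb K=\mathbb R$ or $\mathbb K=\mathbb C$. $B_X$ and $B_X^\circ$ denote the closed and the open unit ball of a Banach space $X$, and $B(x,\delta)=\{y\in X:\|y-x\|<\delta\}$. A topological space $K$ is scattered if every non-empty subset $A$ of $K$ contains a point which is isolated in $A$. For a locally compact Hausdorff space $K$, $C_0(K,X)$ is the Banach space of continuous functions $K\to X$ vanishing at infinity, with the supremum norm. A finite convex combination of relatively weakly open subsets of $B_X$ is a set $C=\sum_{j=1}^n\lambda_jU_j=\{\sum_{j=1}^n\lambda_ju_j: u_j\in U_j\}$, where $n\in\mathbb N$, each $U_j\subset B_X$ is open in the relative weak topology of $B_X$, $\lambda_j>0$ and $\sum_{j=1}^n\lambda_j=1$. The space $X$ has property CWO if every such $C$ is open in the relative weak topology of $B_X$. The space $X$ has property CWO-$B$ if, for every such $C$, every $x\in C\cap B_X^\circ$ is an interior point of $C$ in the relative weak topology of $B_X$. A point $x\in B_X$ has property (co) if for every $n\in\mathbb N$, $n\ge2$, the following holds: whenever $x_1,\dots,x_n\in B_X$ and $\lambda_1,\dots,\lambda_n>0$, $\sum_{j=1}^n\lambda_j=1$, are such that $x=\sum_{j=1}^n\lambda_jx_j$, and $\varepsilon>0$, there is a $\delta>0$ such that, setting $B:=B(x,\delta)\cap B_X$, there are (norm-)continuous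 functions $\widehat v_j:B\to B_X$, $j\in\{1,\dots,n\}$, such that for every $u\in B$ one has $u=\sum_{j=1}^n\lambda_j\widehat v_j(u)$ and $\|\widehat v_j(u)-x_j\|<\varepsilon$ for every $j\in\{1,\dots,n\}$. The space $X$ has property (co) if every point $x\in B_X$ has property (co). *)

(* Defs.v *)
From HB Require Import structures.
From mathcomp Require Import all_boot all_order all_algebra.
From mathcomp Require Import all_classical all_reals all_analysis.
From mathcomp Require Import complex ring.

Set Implicit Arguments.
Unset Strict Implicit.
Unset Printing Implicit Defensive.

Import Order.TTheory GRing.Theory Num.Theory.
Import numFieldNormedType.Exports.

Local Open Scope classical_set_scope.
Local Open Scope ring_scope.

Variant scalar_kind := RealScalars | ComplexScalars.

(* In [R[i]], [0 < e] means that [e] is a positive real number, so that radii,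
   norms and convex coefficients can all be taken in the scalar field. *)
Definition scalars (R : realType) (k : scalar_kind) : numFieldType :=
  match k with
  | RealScalars => R
  | ComplexScalars => R[i]
  end.

Section Notions.
Variable K : numFieldType.

Definition finite_dimensional (X : lmodType K) : Prop :=
  exists (n : nat) (e : 'I_n -> X),
    forall x : X, exists c : 'I_n -> K, x = \sum_(j < n) c j *: e j.

Definition scattered (T : topologicalType) : Prop :=
  forall A : set T, A !=set0 -> exists x, isolated A x.

Definition unit_ball (X : normedModType K) : set X := [set x | `|x| <= 1].

Definition open_unit_ball (X : normedModType K) : set X := [set x | `|x| < 1].

Definition dual (X : normedModType K) : Type :=
  {phi : {linear X -> K^o} | continuous phi}.

(* An alias of [X], so that [open] on [weak X] refers to the weak topology. *)
Definition weak (X : normedModType K) : Type := X.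

HB.instance Definition _ (X : normedModType K) :=
  Topological.copy (weak X)
    (sup_topology (fun phi : dual X =>
       Topological.class (initial_topology (sval phi : X -> K^o)))).

Definition relatively_weakly_open (X : normedModType K) (U : set X) : Prop :=
  exists2 V : set (weak X), open V & U = @unit_ball X `&` V.

Definition convex_combination (X : normedModType K) (n : nat)
    (lambda : 'I_n -> K) (U : 'I_n -> set X) : set X :=
  [set x | exists2 u : 'I_n -> X,
     forall j, U j (u j) & x = \sum_(j < n) lambda j *: u j].

Definition weakly_open_combination (X : normedModType K) (C : set X) : Prop :=
  exists (n : nat) (lambda : 'I_n -> K) (U : 'I_n -> set X),
    [/\ forall j, relatively_weakly_open (U j),
        forall j, 0 < lambda j,
        \sum_(j < n) lambda j = 1
      & C = convex_combination lambda U].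

Definition CWO (X : normedModType K) : Prop :=
  forall C : set X, weakly_open_combination C -> relatively_weakly_open C.

Definition CWO_B (X : normedModType K) : Prop :=
  forall C : set X, weakly_open_combination C ->
  forall x, (C `&` @open_unit_ball X) x ->
  exists W : set X, [/\ relatively_weakly_open W, W x & W `<=` C].

Definition co_at (X : normedModType K) (x : X) : Prop :=
  forall n : nat, (2 <= n)%N ->
  forall (xs : 'I_n -> X) (lambda : 'I_n -> K),
    (forall j, @unit_ball X (xs j)) ->
    (forall j, 0 < lambda j) ->
    \sum_(j < n) lambda j = 1 ->
    x = \sum_(j < n) lambda j *: xs j ->
  forall eps : K, 0 < eps ->
  exists2 delta : K, 0 < delta &
    let B := ball x delta `&` @unit_ball X in
    exists v : 'I_n -> X -> X,
      [/\ forall j, {within B, continuous (v j)},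
          forall j u, B u -> @unit_ball X (v j u),
          forall u, B u -> u = \sum_(j < n) lambda j *: v j u
        & forall j u, B u -> `|v j u - xs j| < eps].

Definition property_co (X : normedModType K) : Prop :=
  forall x : X, @unit_ball X x -> co_at x.

Definition vanishes_at_infinity (T : topologicalType) (X : normedModType K)
    (f : T -> X) : Prop :=
  forall eps : K, 0 < eps ->
  exists2 C : set T, compact C & forall t, ~ C t -> `|f t| < eps.

End Notions.

Arguments unit_ball {K} X _.
Arguments open_unit_ball {K} X _.

Section ScalarSupremum.
Variables (R : realType) (k : scalar_kind).
Local Notation K := (scalars R k).

Lemma has_supremums (A : set K) :
  A !=set0 -> has_ubound A -> (forall x, A x -> 0 <= x) -> supremums A !=set0.
Proof.
case: k A => /= A [a Aa] [b bA] A0.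
  have hA : has_sup A by split; [exists a | exists b].
  exists (sup A); split; first exact: sup_upper_bound.
  by move=> y Ay; apply: ge_sup => //; exists a.
have im0 (z : R[i]) : 0 <= z -> z = (complex.Re z)%:C%C.
  by case: z => r i; rewrite lecE /= => /andP[/eqP -> _].
have hS : has_sup (@complex.Re R @` A).
  split; first by exists (complex.Re a), a.
  exists (complex.Re b) => _ [z Az <-].
  by have := bA z Az; rewrite lecE => /andP[].
exists (sup (@complex.Re R @` A))%:C%C; split => [z Az|z zA].
  rewrite (im0 z (A0 z Az)) lecR; apply: (sup_upper_bound hS).
  by exists z.
have z0 : 0 <= z by apply: le_trans (zA a Aa); exact: A0.
rewrite (im0 z z0) lecR; apply: ge_sup; first by case: hS.
move=> _ [w Aw <-]; have := zA w Aw.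
by rewrite lecE => /andP[].
Qed.

End ScalarSupremum.

Section C0Space.
Variables (R : realType) (k : scalar_kind).
Local Notation K := (scalars R k).
Variables (T : topologicalType) (X : normedModType K).

Definition C0_pred : {pred T -> X} :=
  mem [set f : T -> X | continuous f /\ vanishes_at_infinity f].

Lemma C0_submod : submod_closed C0_pred.
Proof.
split=> [|a f g]; rewrite !inE /=.
  split; first exact: cst_continuous.
  move=> e e0; exists set0; first exact: compact0.
  by move=> t _; rewrite normr0.
move=> [cf vf] [cg vg]; split.
  move=> t; apply: cvgD; last exact: cg.
  by apply: cvgZl_tmp; exact: cf.
move=> e e0; have a1 : 0 < `|a| + 1 by rewrite ltr_wpDl.
have e2 : 0 < e / 2 by rewrite divr_gt0.
have [C cC fC] := vf _ (divr_gt0 e2 a1).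
have [D cD gD] := vg _ e2.
exists (C `|` D); first exact: compactU.
move=> t /not_orP[Ct Dt]; apply: le_lt_trans (ler_normD _ _) _.
rewrite [ltRHS]splitr; apply: ltrD; last exact: gD.
rewrite normrZ; apply: le_lt_trans (_ : _ <= (`|a| + 1) * `|f t|) _.
  by rewrite ler_wpM2r// lerDl.
by rewrite mulrC -ltr_pdivlMr//; exact: fC.
Qed.

HB.instance Definition _ :=
  GRing.isSubmodClosed.Build K (T -> X) C0_pred C0_submod.

Record C0 : Type := MkC0 { C0_fun :> T -> X ; C0_funP : C0_fun \in C0_pred }.

HB.instance Definition _ := [isSub for C0_fun].
HB.instance Definition _ := [Choice of C0 by <:].
HB.instance Definition _ := [SubChoice_isSubLmodule of C0 by <:].

Definition C0_norm (f : C0) : K := supremum 0 (range (fun t => `|f t|)).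

Lemma C0_bounded (f : C0) : has_ubound (range (fun t => `|f t|)).
Proof.
have /set_mem [cf /(_ 1 ltr01) [C /compact_near_coveringP cC fC]] := C0_funP f.
have : \forall M \near +oo, C `<=` [set t | `|f t| <= M].
  apply: cC => t Ct; near (pinfty_nbhs K) => M0.
  exists ([set s | `|f s| <= M0], [set M | M0 <= M]) => /=; last first.
    by move=> [s M] /= [sM]; exact: le_trans.
  split; last by apply: nbhs_pinfty_ge; rewrite ger0_real//; near: M0.
  have tM : `|f t| < M0 by near: M0; apply: nbhs_pinfty_gt; exact: normr_real.
  by have := cf t; move/cvgr_norm_le; apply.
move=> CM; near (pinfty_nbhs K) => M.
exists M => _ [t _ <-]; have [Ct|Ct] := pselect (C t).
  by have /(_ t Ct) : C `<=` [set t | `|f t| <= M] by near: M.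
apply: ltW; apply: lt_le_trans (fC t Ct) _.
by near: M; apply: nbhs_pinfty_ge; exact: real1.
Unshelve. all: by end_near. Qed.

Lemma C0_supremums (f : C0) (t : T) :
  supremums (range (fun s => `|f s|)) (C0_norm f).
Proof.
rewrite /C0_norm /supremum; case: eqP => [f0|_].
  by have : set0 `|f t| by rewrite -f0; exists t.
have [||_ [s _ <-] //|s ?] := @has_supremums R k (range (fun s => `|f s|)).
- by exists `|f t|, t.
- exact: C0_bounded.
exact: (xgetPex 0 (ex_intro _ s _)).
Qed.

Lemma C0_norm_ge (f : C0) (t : T) : `|f t| <= C0_norm f.
Proof. by have [+ _] := C0_supremums f t; apply; exists t. Qed.

Lemma C0_norm_le (f : C0) (M : K) :
  0 <= M -> (forall t, `|f t| <= M) -> C0_norm f <= M.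
Proof.
move=> M0 fM; have [[t _]|Te] := pselect (exists t : T, True).
  by have [_ sM] := C0_supremums f t; apply: (sM M) => y [s _ <-].
rewrite /C0_norm /supremum ifT//; apply/eqP; rewrite -subset0 => y [s _ _].
by apply: Te; exists s.
Qed.

Lemma C0_norm_ge0 (f : C0) : 0 <= C0_norm f.
Proof.
have [[t _]|Te] := pselect (exists t : T, True).
  exact: le_trans (C0_norm_ge f t).
rewrite /C0_norm /supremum ifT//; apply/eqP; rewrite -subset0 => y [s _ _].
by apply: Te; exists s.
Qed.

Lemma C0_normD (f g : C0) : C0_norm (f + g) <= C0_norm f + C0_norm g.
Proof.
apply: C0_norm_le => [|t]; first by rewrite addr_ge0 ?C0_norm_ge0.
by apply: le_trans (ler_normD _ _) _; rewrite lerD ?C0_norm_ge.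
Qed.

Lemma C0_normZ (a : K) (f : C0) : C0_norm (a *: f) = `|a| * C0_norm f.
Proof.
have le b (g : C0) : C0_norm (b *: g) <= `|b| * C0_norm g.
  apply: C0_norm_le => [|t]; first by rewrite mulr_ge0 ?C0_norm_ge0.
  by rewrite normrZ ler_wpM2l ?C0_norm_ge.
apply/eqP; rewrite eq_le le /=.
have [->|a0] := eqVneq a 0; first by rewrite normr0 mul0r C0_norm_ge0.
rewrite mulrC -ler_pdivlMr ?normr_gt0// mulrC -normfV.
by have := le a^-1 (a *: f); rewrite scalerA mulVf// scale1r.
Qed.

Lemma C0_norm_eq0 (f : C0) : C0_norm f = 0 -> f = 0.
Proof.
move=> f0; apply/val_inj/funext => t; apply/eqP.
by rewrite -normr_le0 -f0 C0_norm_ge.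
Qed.

HB.instance Definition _ :=
  Lmodule_isNormed.Build K C0 C0_normD C0_normZ C0_norm_eq0.

End C0Space.

Section C0Complete.
Variables (R : realType) (k : scalar_kind).
Local Notation K := (scalars R k).
Variables (T : topologicalType) (X : completeNormedModType K).

Lemma C0_complete (F : set_system (C0 T X)) :
  ProperFilter F -> cauchy F -> cvg F.
Proof.
move=> FF /cauchyP Fex.
have evc t : cvg ((fun f : C0 T X => f t) @ F).
  apply/cauchy_cvgP/cauchy_exP => e e0; have [f0 Ff0] := Fex e e0.
  exists (f0 t); suff: F [set f : C0 T X | ball (f0 t) e (f t)] by [].
  apply: filterS Ff0 => f; rewrite -!ball_normE /=.
  apply: le_lt_trans; exact: (C0_norm_ge (f0 - f)).
pose g t : X := lim ((fun f : C0 T X => f t) @ F).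
have unif e : 0 < e -> exists2 f0 : C0 T X, F (ball f0 e) &
    forall t, `|f0 t - g t| < e.
  move=> e0; have e2 : 0 < e / 2 by rewrite divr_gt0.
  have [f0 Ff0] := Fex _ e2.
  exists f0; first by apply: filterS Ff0; apply: le_ball;
    rewrite ler_pdivrMr// ler_peMr ?ler1n// ltW.
  move=> t; near F => f.
  rewrite [ltRHS]splitr -(subrKA (f t)); apply: le_lt_trans (ler_normD _ _) _.
  apply: ltrD.
    have : ball f0 (e / 2) f by near: f.
    by rewrite -ball_normE /=; apply: le_lt_trans; exact: (C0_norm_ge (f0 - f)).
  by rewrite distrC; near: f; apply: cvgr_dist_lt => //; exact: evc.
have gC0 : g \in @C0_pred R k T X.
  rewrite inE; split.
    move=> t; apply/cvgrPdist_lt => e e0.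
    have e3 : 0 < e / 3 by rewrite divr_gt0.
    have [f _ fg] := unif _ e3.
    have /set_mem [cf _] := C0_funP f.
    near=> s.
    rewrite (_ : g t - g s = (g t - f t) + (f t - f s) + (f s - g s)); last first.
      by rewrite !addrA !subrK.
    rewrite (_ : e = e / 3 + e / 3 + e / 3); last first.
      by field.
    apply: le_lt_trans (ler_normD _ _) _; apply: ltrD => //.
    apply: le_lt_trans (ler_normD _ _) _; apply: ltrD.
      by rewrite distrC.
    by near: s; apply: cvgr_dist_lt => //; exact: cf.
  move=> e e0; have e2 : 0 < e / 2 by rewrite divr_gt0.
  have [f _ fg] := unif _ e2.
  have /set_mem [_ /(_ _ e2) [C cC fC]] := C0_funP f.
  exists C => // t Ct; rewrite -[g t](subrK (f t)) [ltRHS]splitr.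
  apply: le_lt_trans (ler_normD _ _) _; apply: ltrD; last exact: fC.
  by rewrite distrC.
apply/cvg_ex; exists (MkC0 gC0); apply/cvgrPdist_le => e e0.
have e2 : 0 < e / 2 by rewrite divr_gt0.
have [f0 Ff0 fg] := unif _ e2; near=> f.
apply: C0_norm_le => [|t]; first exact: ltW.
rewrite (_ : _ t = (g t - f0 t) + (f0 t - f t)); last by rewrite subrKA.
rewrite [leRHS]splitr.
apply: le_trans (ler_normD _ _) _; apply: lerD; apply: ltW.
  by rewrite distrC; exact: fg.
have : ball f0 (e / 2) f by near: f.
by rewrite -ball_normE /=; apply: le_lt_trans; exact: (C0_norm_ge (f0 - f)).
Unshelve. all: by end_near. Qed.

HB.instance Definition _ := Uniform_isComplete.Build (C0 T X) C0_complete.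

End C0Complete.

(* Main.v *)
From HB Require Import structures.
Require Import Defs.
From mathcomp Require Import all_boot all_order all_algebra.
From mathcomp Require Import all_classical all_reals all_analysis.
From mathcomp Require Import complex ring.

(** On the unit ball of [C0 K X] the weak topology is the topology of pointwise
    convergence, and this reduces the theorem to finitely many points of [K].

    For the functionals, scatteredness is used in place of the representation
    of the dual as an l1-sum over [K]: a continuous functional [phi] is atomic,
    in the sense that for every [e] there is a finite [F] such that [phi] is at
    most [e] on the functions of the unit ball that vanish on [F]
    ([atomic_on_setT]).  If an open set can be covered by open sets where [phi]
    is atomic but [phi] is not atomic on it, one finds there infinitely many
    disjointly supported bumps on each of which [phi] is at least [e / 3], and
    adding them up contradicts boundedness ([atomic_on_open]); an isolated
    point of the set of bad points is then absorbed in the finite set [F].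
    Conversely the evaluations [f |-> f t] are weakly continuous into the norm
    topology because [X] is finite dimensional ([weak_nbhs_eval]).

    Hence each weakly open [U_j] contains, around [f_j], all functions of the
    ball that are close to [f_j] on a finite set [F].  Let [f] be the convex
    combination of the [f_j].  If every value [f t] has property (co), then
    near each [t] in [F] the functions [v_j] given by (co) split the values of
    any [g] close to [f] on [F] into convex combinations of points close to
    [f_j t].  Since [K] has a base of compact clopen sets
    ([compact_clopen_nbhs]), one may use [v_j (g s)] for [s] in a small compact
    clopen neighbourhood of each point of [F] and [g s] elsewhere: these
    functions are continuous, stay in the ball, and combine to [g]
    ([pointwise_selection]).

    Points of the open unit ball of [X] always have property (co)
    ([co_at_interior]), which gives part (a); part (b) assumes it for all
    points of the ball. *)

Set Implicit Arguments.
Unset Strict Implicit.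
Unset Printing Implicit Defensive.

Import Order.TTheory GRing.Theory Num.Theory.
Import numFieldNormedType.Exports.

Local Open Scope classical_set_scope.
Local Open Scope ring_scope.

(** * Scattered locally compact spaces *)

Section ScatteredTopology.
Variable T : topologicalType.

(** An isolated point of the set of counterexamples to [P] has a neighbourhood
    in which every other point satisfies [P]. *)
Lemma scattered_ind (P : T -> Prop) : scattered T ->
  (forall t, (\forall s \near t, s <> t -> P s) -> P t) -> forall t, P t.
Proof.
move=> scT step t; apply: contrapT => NPt.
have [|x [/set_mem NPx [V Vx VP]]] := scT [set s | ~ P s]; first by exists t.
apply: NPx; apply: step; apply: filterS Vx => s Vs sx.
by apply: contrapT => NPs; apply: sx; have : [set x] s by rewrite -VP.
Qed.

(** Otherwise the sets [A `\` L] with [Q L] generate a proper filter, and a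
    cluster point of it in [A] cannot have a neighbourhood satisfying [Q]. *)
Lemma compact_cover_ind (Q : set T -> Prop) (A : set T) :
  Q set0 -> setU_closed Q -> compact A ->
  (forall t, A t -> exists2 V, nbhs t V & Q V) ->
  exists2 L, Q L & A `<=` L.
Proof.
move=> Q0 QU cA locQ; apply: contrapT => NL.
have PF : ProperFilter (filter_from Q (fun L => A `\` L)).
  apply: filter_from_proper.
    apply: filter_from_filter; first by exists set0.
    move=> L M QL QM; exists (L `|` M); first exact: QU.
    by move=> t [At /not_orP[Lt Mt]].
  move=> L QL; apply: contrapT => AL; apply: NL; exists L => // t At.
  by apply: contrapT => Lt; apply: AL; exists t.
have [|a [Aa cla]] := cA _ PF; first by exists set0 => // t [].
have [V Va QV] := locQ a Aa.
have [|t [[_ Vt] /Vt //]] := cla (A `\` V) V _ Va.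
by exists V.
Qed.

Definition compact_clopen (V : set T) : Prop := compact V /\ clopen V.

Lemma compact_clopen0 : compact_clopen set0.
Proof. by split; [exact: compact0 | exact: clopen0]. Qed.

Lemma compact_clopenU : setU_closed compact_clopen.
Proof.
move=> V W [cV oV] [cW oW].
by split; [exact: compactU | exact: clopenU].
Qed.

Lemma nbhs_compact_clopen (V : set T) t : compact_clopen V -> V t -> nbhs t V.
Proof. by move=> [_ [oV _]] Vt; apply: open_nbhs_nbhs. Qed.

Hypothesis hausT : hausdorff_space T.

Lemma compact_clopenD (V W : set T) :
  compact_clopen V -> clopen W -> compact_clopen (V `\` W).
Proof.
move=> [cV oV] oW; rewrite setDE.
have oVW : clopen (V `&` ~` W) by apply: clopenI => //; exact: clopenC.
by split=> //; apply: (@subclosed_compact _ _ V) => //; case: oVW.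
Qed.

Hypothesis lcT : locally_compact [set: T].
Hypothesis scT : scattered T.

(** Zero-dimensionality, by [scattered_ind]: if all points near [t] other than
    [t] already have small compact clopen neighbourhoods, the boundary of a
    small neighbourhood [U] of [t] is covered by a compact clopen set [L] that
    avoids [t], and removing [L] from [U] leaves a clopen set. *)
Lemma compact_clopen_nbhs (t : T) (O : set T) :
  nbhs t O -> exists V, [/\ compact_clopen V, V t & V `<=` O].
Proof.
move: t O; apply: (scattered_ind scT) => t ih O Ot.
have [C CT [cC _]] := lcT (I : [set: T] t).
rewrite /within /= in CT.
have Ct : nbhs t C by apply: filterS CT => s; exact.
have [M Mt MO] : exists2 M, nbhs t M &
    closure M `<=` (C `&` O `&` [set s | s <> t ->
      forall O, nbhs s O -> exists V, [/\ compact_clopen V, V s & V `<=` O]])°.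
  apply: (compact_regular hausT cC Ct); apply: nbhs_interior.
  by apply: filterI ih; exact: filterI.
set N := interior _ in MO; set U := interior M.
have clUM : closure U `<=` closure M by apply: closureS; exact: interior_subset.
have UN : closure U `<=` N by exact: subset_trans MO.
have subN : N `<=` _ := @interior_subset _ _.
have cclU : compact (closure U).
  apply: subclosed_compact cC _; first exact: closed_closure.
  by move=> s /UN /subN [[]].
have oU : open U by exact: open_interior.
have t1 : closed [set t].
  by apply: accessible_closed_set1; exact: hausdorff_accessible.
(* The boundary of [U] lies in [N] and avoids [t]. *)
have [|||s [clUs Us]|L [cL LN] UL] := @compact_cover_ind
  (fun V => compact_clopen V /\ V `<=` N `\ t) (closure U `\` U).
- by split; [exact: compact_clopen0 | exact: sub0set].
- move=> V W [cV VN] [cW WN]; split; first exact: compact_clopenU.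
  by rewrite subUset.
- apply: (@subclosed_compact _ _ (closure U)) => //.
  by rewrite setDE; apply: closedI; [exact: closed_closure | exact: open_closedC].
- have st : s <> t by move=> st; apply: Us; rewrite st.
  have [_ /(_ st) good_s] := subN _ (UN _ clUs).
  have [|V [cV Vs VN]] := good_s (N `\ t); last first.
    by exists V; first exact: nbhs_compact_clopen.
  apply: open_nbhs_nbhs; split; last by split; first exact: UN.
  by rewrite setDE; apply: openI; [exact: open_interior | exact: closed_openC].
have [cpL [opL clL]] := cL.
have ULE : U `\` L = closure U `\` L.
  apply/seteqP; split => s [Us Ls]; split=> //; first exact: subset_closure.
  by apply: contrapT => NUs; apply: Ls; exact: UL.
have closedUL : closed (U `\` L).
  by rewrite ULE setDE; apply: closedI; [exact: closed_closure | exact: open_closedC].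
exists (U `\` L); split.
- split; last by split=> //; rewrite setDE; apply: openI => //; exact: closed_openC.
  apply: subclosed_compact closedUL cclU _ => s [Us _].
  exact: subset_closure.
- by split=> // /LN [_]; exact.
- by move=> s [/subset_closure /UN /subN [[]]].
Qed.

Lemma compact_clopen_between (P : set T -> Prop) (A O : set T) :
  P set0 ->
  (forall V W, compact_clopen V -> compact_clopen W ->
    P V -> P W -> P (V `|` W)) ->
  (forall V W, P V -> W `<=` V -> P W) ->
  (forall t, A t -> exists2 V, nbhs t V & P V) ->
  compact A -> open O -> A `<=` O ->
  exists V, [/\ compact_clopen V, A `<=` V, V `<=` O & P V].
Proof.
move=> P0 PU PS locP cA oO AO.
have [|||t At|L [cL LO PL] AL] := @compact_cover_ind
  (fun V => [/\ compact_clopen V, V `<=` O & P V]) A.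
- by split=> //; exact: compact_clopen0.
- move=> V W [cV VO PV] [cW WO PW]; split; first exact: compact_clopenU.
    by rewrite subUset.
  exact: PU.
- exact: cA.
- have [V Vt PV] := locP t At.
  have [|W [cW Wt WVO]] := @compact_clopen_nbhs t (V `&` O).
    by apply: filterI => //; apply: open_nbhs_nbhs; split=> //; exact: AO.
  exists W; first exact: nbhs_compact_clopen.
  by split=> //; [move=> s /WVO [] | apply: PS PV _ => s /WVO []].
by exists L.
Qed.

End ScatteredTopology.

(** * Cutting and patching functions of [C0] along compact clopen sets *)

Section C0Cut.
Variables (R : realType) (k : scalar_kind).
Local Notation K := (scalars R k).
Variables (T : topologicalType) (X : normedModType K).
Implicit Types f g h : C0 T X.

Lemma C0_continuous f : continuous f.
Proof. by have /set_mem [] := C0_funP f. Qed.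

Lemma C0_vanishes f : vanishes_at_infinity f.
Proof. by have /set_mem [] := C0_funP f. Qed.

Lemma C0_sumE n (F : 'I_n -> C0 T X) t : (\sum_j F j) t = \sum_j F j t.
Proof. exact: (big_morph (fun f : C0 T X => f t)). Qed.

Lemma C0_ext f g : f =1 g -> f = g.
Proof. by move=> fg; apply/val_inj/funext. Qed.

Lemma ler_C0_norm f (M : K) : 0 <= M -> (forall t, `|f t| <= M) -> `|f| <= M.
Proof. exact: C0_norm_le. Qed.

Lemma C0_norm_at f t : `|f t| <= `|f|.
Proof. exact: C0_norm_ge. Qed.

Lemma C0_patch (N : set T) (h : T -> X) f :
  compact_clopen N -> {in N, continuous h} ->
  exists g, forall s, g s = patch f N h s.
Proof.
move=> [cN [oN clN]] ch.
suff gC : patch f N h \in @C0_pred R k T X by exists (MkC0 gC).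
rewrite inE; split.
  move=> t; have [Nt|Nt] := pselect (N t).
    have tN : t \in N by rewrite inE.
    rewrite /continuous_at {2}/patch tN; apply: cvg_trans (ch t tN).
    apply: near_eq_cvg; have : nbhs t N by apply: open_nbhs_nbhs.
    by apply: filterS => s Ns; rewrite /patch ifT// inE.
  have tN : (t \in N) = false by apply/negbTE; rewrite notin_setE.
  rewrite /continuous_at {2}/patch tN; apply: cvg_trans (@C0_continuous f t).
  apply: near_eq_cvg.
  have : nbhs t (~` N) by apply: open_nbhs_nbhs; split=> //; exact: closed_openC.
  by apply: filterS => s Ns; rewrite /patch ifF//; apply/negbTE; rewrite notin_setE.
move=> e e0; have [C cC fC] := C0_vanishes f e0.
exists (C `|` N); first exact: compactU.
move=> t /not_orP[Ct Nt]; rewrite /patch ifF; first exact: fC.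
by apply/negbTE; rewrite notin_setE.
Qed.

(** [g] and [h] are the restrictions of [f] to [N] and to its complement,
    extended by [0]. *)
Lemma C0_split (N : set T) f : compact_clopen N ->
  exists g h, [/\ f = g + h,
    forall s, N s -> g s = f s /\ h s = 0,
    forall s, ~ N s -> g s = 0 /\ h s = f s,
    `|g| <= `|f| & `|h| <= `|f|].
Proof.
move=> cN; have [|h hE] := @C0_patch N 0 f cN; first by move=> s _; exact: cvg_cst.
have hN s : N s -> h s = 0 by move=> Ns; rewrite hE /patch ifT// inE.
have hNC s : ~ N s -> h s = f s.
  by move=> Ns; rewrite hE /patch ifF//; apply/negbTE; rewrite notin_setE.
have gN s : N s -> (f - h) s = f s.
  by move=> Ns; rewrite [LHS](_ : _ = f s - h s)// hN// subr0.
have gNC s : ~ N s -> (f - h) s = 0.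
  by move=> Ns; rewrite [LHS](_ : _ = f s - h s)// hNC// subrr.
exists (f - h), h; split; first by rewrite subrK.
- by move=> s Ns; rewrite gN// hN.
- by move=> s Ns; rewrite gNC// hNC.
- apply: ler_C0_norm => // s; have [Ns|Ns] := pselect (N s).
    by rewrite gN// C0_norm_at.
  by rewrite gNC// normr0.
apply: ler_C0_norm => // s; have [Ns|Ns] := pselect (N s).
  by rewrite hN// normr0.
by rewrite hNC// C0_norm_at.
Qed.

Lemma C0_small_open f (e : K) : open [set t | `|f t| < e].
Proof.
rewrite openE => t /= fe; rewrite /interior /=.
exact: (@cvgr_norm_lt _ _ _ _ _ _ _ (@C0_continuous f t)).
Qed.

Lemma C0_large_compact f (e : K) : 0 < e -> compact [set t | ~ `|f t| < e].
Proof.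
move=> e0; have [C cC fC] := C0_vanishes f e0.
apply: (@subclosed_compact _ _ C) => //; last first.
  by move=> t /= ef; apply: contrapT => /fC.
exact/open_closedC/C0_small_open.
Qed.

End C0Cut.

(** * Continuous functionals on [C0] are atomic *)

(** Over the complex numbers the order compares the real parts of numbers with
    equal imaginary parts, so the real case applies to the real parts. *)
Lemma scalars_archi (R : realType) (k : scalar_kind) (a b : scalars R k) :
  0 < a -> (forall n, a *+ n <= b) -> False.
Proof.
have archi (x y : R) : 0 < x -> (forall n, x *+ n <= y) -> False.
  move=> x0 xy; have y0 : 0 <= y by have := xy 0%N.
  have := xy (Num.bound (y / x)); apply/negP.
  rewrite -ltNge -mulr_natl -ltr_pdivrMr//.
  by apply: archi_boundP; rewrite divr_ge0// ltW.
case: k a b => /= a b; first exact: archi.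
rewrite ltcE => /andP[_ a0] nab.
apply: (archi (complex.Re a) (complex.Re b)) => [|n]; first by [].
have ReMn m : complex.Re (a *+ m) = complex.Re a *+ m.
  elim: m => [|m ih]; rewrite ?mulr0n// !mulrS -ih.
  by case: (a) => ? ?; case: (_ *+ _).
by have := nab n; rewrite lecE -ReMn => /andP[_].
Qed.

Section AtomicFunctionals.
Variables (R : realType) (k : scalar_kind).
Local Notation K := (scalars R k).
Variables (T : topologicalType) (X : normedModType K).
Implicit Types f g h : C0 T X.
Hypothesis hausT : hausdorff_space T.
Hypothesis lcT : locally_compact [set: T].
Hypothesis scT : scattered T.
Variable phi : {linear C0 T X -> K^o}.
Hypothesis cphi : continuous phi.

Lemma dual_bound : exists2 M : K, 0 < M & forall f, `|phi f| <= M * `|f|.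
Proof.
have /linear_bounded_continuous/linear_boundedP := cphi.
by move=> /pinfty_ex_gt0 [M M0 phiM]; exists M.
Qed.

(** In terms of the vector measure that represents [phi], its variation on [V]
    is concentrated, up to [e], on a finite set. *)
Definition atomic_on (V : set T) := forall e : K, 0 < e ->
  exists F : seq T, forall g, `|g| <= 1 -> (forall s, ~ V s -> g s = 0) ->
    (forall s, s \in F -> g s = 0) -> `|phi g| <= e.

Lemma atomic_on0 : atomic_on set0.
Proof.
move=> e e0; exists [::] => g _ g0 _.
have -> : g = 0 by apply: C0_ext => s; exact: g0.
by rewrite linear0 normr0 ltW.
Qed.

Lemma atomic_onS (V W : set T) : atomic_on V -> W `<=` V -> atomic_on W.
Proof.
move=> aV WV e e0; have [F FV] := aV e e0; exists F => g g1 gW gF.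
by apply: FV => // s Vs; apply: gW => /WV.
Qed.

Lemma atomic_onU (V W : set T) : compact_clopen V -> compact_clopen W ->
  atomic_on V -> atomic_on W -> atomic_on (V `|` W).
Proof.
move=> cV cW aV aW e e0; have e2 : 0 < e / 2 by rewrite divr_gt0.
have [F FV] := aV _ e2; have [G GW] := aW _ e2; exists (F ++ G) => g g1 g0 gFG.
have [g' [h [gE gV gNV g'1 h1]]] := C0_split g cV.
rewrite gE linearD [leRHS]splitr; apply: le_trans (ler_normD _ _) _; apply: lerD.
  apply: FV => [|s /gNV[]//|s sF]; first exact: le_trans g1.
  have gs : g s = 0 by apply: gFG; rewrite mem_cat sF.
  by have [/gV[-> _]|/gNV[]] := pselect (V s).
apply: GW => [|s Ws|s sG]; first exact: le_trans g1.
  have [/gV[]//|Vs] := pselect (V s); have [_ ->] := gNV _ Vs.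
  by apply: g0 => -[].
have gs : g s = 0 by apply: gFG; rewrite mem_cat sG orbT.
by have [/gV[]|/gNV[_ ->]] := pselect (V s).
Qed.

(** If the conclusion fails for [e], then for every compact clopen [L] in [S]
    on which [phi] is atomic there is a function in the unit ball, supported in
    [S] off [L], on which [phi] is at least [e / 3]: split a counterexample [f]
    for the finite set of [L] into its part on [L], its part on a compact clopen
    [L' `\` L] containing the points off [L] where [f] is large, and a
    uniformly small rest.  Iterating, the sum of [n] such disjointly supported
    functions remains in the unit ball while its image grows like
    [n * (e / 3)]. *)
Lemma atomic_on_open (S : set T) : open S ->
  (forall t, S t -> exists2 V, nbhs t V & atomic_on V) -> atomic_on S.
Proof.
move=> oS locS e e0; apply: contrapT => NF.
have [M M0 phiM] := dual_bound.
have e3 : 0 < e / 3 by rewrite divr_gt0.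
have cover (A : set T) : compact A -> A `<=` S ->
    exists L, [/\ compact_clopen L, A `<=` L, L `<=` S & atomic_on L].
  move=> cA AS; apply: compact_clopen_between => //.
  - exact: atomic_on0.
  - exact: atomic_onU.
  - exact: atomic_onS.
  - by move=> t /AS; exact: locS.
have bumps n : exists L g, [/\ compact_clopen L, L `<=` S & atomic_on L] /\
    [/\ `|g| <= 1, forall s, ~ L s -> g s = 0 & (e / 3) *+ n <= phi g].
  elim: n => [|n [L [g [[cL LS aL] [g1 gL phig]]]]].
    exists set0, 0; split.
      by split; [exact: compact_clopen0 | exact: sub0set | exact: atomic_on0].
    by split=> //; rewrite ?normr0// linear0.
  have [F FL] := aL _ e3.
  have [f [f1 fS fF]] : exists f, [/\ `|f| <= 1, forall s, ~ S s -> f s = 0 &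
      (forall s, s \in F -> f s = 0) /\ e < `|phi f|].
    apply: contrapT => Nf; apply: NF; exists F => f f1 fS fF.
    rewrite real_leNgt ?normr_real ?gtr0_real//; apply/negP => phif.
    by apply: Nf; exists f.
  have [L' [cL' AL' L'S aL']] : exists L', [/\ compact_clopen L',
      [set s | ~ `|f s| < e / 3 / M] `|` L `<=` L', L' `<=` S & atomic_on L'].
    apply: cover.
      apply: compactU; last by case: cL.
      by apply: C0_large_compact; rewrite divr_gt0.
    rewrite subUset; split=> // s /= fs; apply: contrapT => /fS f0.
    by apply: fs; rewrite f0 normr0 divr_gt0.
  have [fin [fout [fE finL foutL fin1 fout1]]] := C0_split f cL.
  have cL'L : compact_clopen (L' `\` L) by apply: compact_clopenD => //; case: cL.
  have [h [r [hE hL' rL' h1 r1]]] := C0_split fout cL'L.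
  (* [fin] vanishes on [F], and [r] is below [e / 3 / M] everywhere. *)
  have phifin : `|phi fin| <= e / 3.
    apply: FL => [|s /foutL[]//|s sF]; first exact: le_trans f1.
    have fs0 : f s = 0 by case: fF => [+ _]; apply.
    by have [/finL[-> _]|/foutL[]] := pselect (L s).
  have phir : `|phi r| <= e / 3.
    apply: le_trans (phiM r) _; rewrite mulrC -ler_pdivlMr//.
    apply: ler_C0_norm => [|s]; first by rewrite ltW// divr_gt0.
    have [/hL'[_ ->]|LL's] := pselect ((L' `\` L) s).
      by rewrite normr0 ltW// divr_gt0.
    have [_ ->] := rL' s LL's; have [/finL[_ ->]|Ls] := pselect (L s).
      by rewrite normr0 ltW// divr_gt0.
    have [_ ->] := foutL s Ls; apply/ltW; apply: contrapT => fs.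
    by apply: LL's; split=> //; apply: AL'; left.
  have phih : e / 3 <= `|phi h|.
    have : `|phi f| <= e / 3 + (`|phi h| + e / 3).
      rewrite fE hE 2!linearD; apply: le_trans (ler_normD _ _) _.
      by apply: lerD => //; apply: le_trans (ler_normD _ _) _; rewrite lerD.
    case: fF => _ /lt_le_trans/[apply] /ltW.
    rewrite [X in X <= _](_ : _ = e / 3 + (e / 3 + e / 3)); last by field.
    by rewrite lerD2l lerD2r.
  have phih0 : phi h != 0 by rewrite -normr_gt0; exact: lt_le_trans phih.
  (* The rotation [c] makes the new contribution real and nonnegative. *)
  pose c : K := `|phi h| / phi h.
  have c1 : `|c| = 1 by rewrite normrM normfV normr_id divff// normr_eq0.
  exists L', (g + c *: h); split; first by [].
  have hL s : L s -> h s = 0 by move=> Ls; have [] := rL' s => // -[].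
  have hNL' s : ~ L' s -> h s = 0 by move=> Ls; have [] := rL' s => // -[].
  have ghE s : (g + c *: h) s = g s + c *: h s by [].
  split.
  - apply: ler_C0_norm => // s; rewrite ghE; have [Ls|Ls] := pselect (L s).
      by rewrite hL// scaler0 addr0; exact: le_trans (C0_norm_at _ _) g1.
    rewrite gL// add0r normrZ c1 mul1r; apply: le_trans (C0_norm_at _ _) _.
    by apply: le_trans h1 _; exact: le_trans f1.
  - move=> s L's; rewrite ghE hNL'// scaler0 addr0 gL// => Ls.
    by apply: L's; apply: AL'; right.
  - rewrite linearD linearZ mulrSr lerD//.
    by rewrite [leRHS](_ : _ = c * phi h)// divfK.
apply: (@scalars_archi R k (e / 3) M e3) => n.
have [L [g [_ [g1 _ phig]]]] := bumps n; apply: le_trans (phig) _.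
have phig0 : 0 <= phi g by apply: le_trans phig; rewrite mulrn_wge0// ltW.
rewrite -(ger0_norm phig0); apply: le_trans (phiM g) _.
by rewrite ger_pMr.
Qed.

(** By [scattered_ind] every point has a neighbourhood on which [phi] is
    atomic: if that holds around all other points of an open [O], then [phi] is
    atomic on [O `\ t] and the point [t] is added to the finite set. *)
Lemma atomic_on_setT : atomic_on [set: T].
Proof.
apply: atomic_on_open; first exact: openT.
move=> + _; apply: (scattered_ind scT) => t.
move=> /nbhs_interior tO; set O := interior _ in tO.
have oO : open O by exact: open_interior.
have OP : O `<=` _ := @interior_subset _ _.
exists O; first exact: tO.
have aO : atomic_on (O `\ t).
  apply: atomic_on_open => [|s [Os st]]; last exact: OP.
  rewrite setDE; apply: openI => //; apply: closed_openC.
  by apply: accessible_closed_set1; exact: hausdorff_accessible.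
move=> e e0; have [F FO] := aO e e0; exists (t :: F) => g g1 gO gF.
apply: FO => // s; last by move=> sF; apply: gF; rewrite inE sF orbT.
move=> OtN; have [->|st] := pselect (s = t); first by apply: gF; rewrite inE eqxx.
by apply: gO => Os; exact: OtN.
Qed.

(** A function small on [F] is small on a compact clopen neighbourhood of [F];
    cutting it there leaves a function vanishing on [F].  The bound [2] is that
    of a difference of two functions of the unit ball. *)
Lemma dual_pointwise_small (e : K) : 0 < e ->
  exists (F : seq T) (d : K), 0 < d /\
    forall f, `|f| <= 2 -> (forall t, t \in F -> `|f t| < d) -> `|phi f| < e.
Proof.
move=> e0; have [M M0 phiM] := dual_bound.
have e6 : 0 < e / 6 by rewrite divr_gt0.
have d0 : 0 < e / 3 / M by rewrite !divr_gt0.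
have [F Fphi] := atomic_on_setT e6.
exists F, (e / 3 / M); split=> // f f2 fF.
have [V [cV FV Vsmall _]] : exists V, [/\ compact_clopen V, [set` F] `<=` V,
    V `<=` [set t | `|f t| < e / 3 / M] & True].
  apply: (@compact_clopen_between T hausT lcT scT (fun=> True)) => //.
  - by move=> t _; exists setT => //; exact: filterT.
  - by apply: finite_compact; exact: finite_seq.
  - exact: C0_small_open.
have [g [h [fE gV hV g1 h1]]] := C0_split f cV.
have phig : `|phi g| <= e / 3.
  apply: le_trans (phiM g) _; rewrite mulrC -ler_pdivlMr//.
  apply: ler_C0_norm => [|s]; first exact: ltW.
  have [Vs|/hV[-> _]] := pselect (V s); last by rewrite normr0 ltW.
  by have [-> _] := gV s Vs; exact/ltW/Vsmall.
have phih : `|phi h| <= e / 3.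
  have : `|phi (2^-1 *: h)| <= e / 6.
    apply: Fphi => [|s []//|s sF].
      by rewrite normrZ gtr0_norm// mulrC ler_pdivrMr// mul1r (le_trans h1).
    rewrite [LHS](_ : _ = 2^-1 *: h s)//.
    by have [_ ->] := gV s (FV s sF); rewrite scaler0.
  rewrite linearZ [X in `|X|](_ : _ = 2^-1 * phi h)// normrM gtr0_norm//.
  by rewrite mulrC ler_pdivrMr// [e / 6 * 2](_ : _ = e / 3)//; field.
rewrite fE linearD; apply: le_lt_trans (ler_normD _ _) _.
apply: le_lt_trans (lerD phig phih) _; rewrite -subr_gt0.
by rewrite [ltRHS](_ : _ = e / 3) ?divr_gt0//; field.
Qed.

End AtomicFunctionals.

(** * The weak topology *)

Section WeakTopology.
Variable K : numFieldType.

Lemma cvg_weakP (X : normedModType K) (F : set_system X) (x : X) :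
  Filter F -> F --> (x : weak X) <->
  forall phi : dual X, sval phi @ F --> (sval phi x : K^o).
Proof.
move=> FF; split=> [Fx phi|Fphi].
  have /(_ phi) Fxphi := (cvg_sup _ _ FF).1 Fx.
  apply: cvg_trans (@initial_continuous _ _ (sval phi : X -> K^o) x).
  by move=> A /= /Fxphi.
apply/(@cvg_sup _ _ _ F x) => phi A /= [_ [[C oC <-] Cx CA]].
rewrite nbhs_filterE; apply: filterS CA _; apply: (Fphi phi).
exact: open_nbhs_nbhs.
Qed.

Lemma dual_weak_continuous (X : normedModType K) (phi : dual X) :
  continuous (sval phi : weak X -> K^o).
Proof. by move=> x; exact: (cvg_weakP x (nbhs_filter (x : weak X))).1 cvg_id phi. Qed.

Lemma relatively_weakly_open_nbhs (X : normedModType K) (C : set X) :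
  (forall x, C x -> `|x| <= 1) ->
  (forall x, C x -> exists2 V, nbhs (x : weak X) V &
    forall y, `|y| <= 1 -> V y -> C y) ->
  relatively_weakly_open C.
Proof.
move=> C1 Cnbhs.
pose V : set (weak X) := [set x | nbhs x [set y : weak X | `|y : X| <= 1 -> C y]].
exists V; first exact: open_interior.
apply/seteqP; split=> [x Cx|x [x1 Vx]]; last exact: (nbhs_singleton Vx x1).
split; first exact: C1.
have [W Wx WC] := Cnbhs x Cx; rewrite /V /=; apply: filterS Wx => y Wy y1.
exact: WC.
Qed.

Lemma cvg_sum_ord (V : normedModType K) (T : Type) (F : set_system T)
    (n : nat) (f : 'I_n -> T -> V) (a : 'I_n -> V) : Filter F ->
  (forall i, f i @ F --> a i) -> \sum_i f i t @[t --> F] --> \sum_i a i.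
Proof.
move=> FF fa; elim: n f a fa => [|n ih] f a fa.
  by under eq_cvg do rewrite big_ord0; rewrite big_ord0; exact: cvg_cst.
under eq_cvg do rewrite big_ord_recr /=; rewrite big_ord_recr /=.
by apply: cvgD => //; exact: ih.
Qed.

End WeakTopology.

(** * Weak and norm convergence agree in finite dimension *)

Section FiniteDimension.
Variables (R : realType) (k : scalar_kind).
Local Notation K := (scalars R k).

(** Over the complex numbers [B] is the square of the numbers whose real and
    imaginary parts have absolute value at most [1], the continuous image of a
    product of two segments. *)
Lemma disc_sub_compact :
  exists2 B : set K, compact B & forall z : K, `|z| <= 1 -> B z.
Proof.
have cI : compact [set` `[(-1 : R), 1]] := @segment_compact R (-1) 1.
case: k => /=.
  by exists [set` `[(-1 : R), 1]] => // z; rewrite ler_norml /= in_itv.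
have normR (x : R) : `|x%:C%C| = `|x|%:C%C :> R[i].
  by rewrite normc_def /= expr0n addr0 sqrtr_sqr.
pose C : numFieldType := R[i].
pose f (p : R * R) : C := (p.1)%:C%C + 'i%C * (p.2)%:C%C.
have cf : continuous f.
  have cC : continuous (fun x : R => x%:C%C : C).
    move=> x; apply/cvgrPdist_lt => e; rewrite ltcE => /andP[/eqP Ime e0].
    near=> y; rewrite -rmorphB normR ltcE Ime eqxx /=.
    by near: y; exists (complex.Re e).
  move=> [x y]; apply: cvgD; first by apply: continuous_cvg; [exact: cC|exact: cvg_fst].
  by apply: cvgMr; apply: continuous_cvg; [exact: cC|exact: cvg_snd].
exists (f @` ([set` `[(-1 : R), 1]] `*` [set` `[(-1 : R), 1]])).
  by apply: continuous_compact; [exact: continuous_subspaceT | exact: compact_setX].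
move=> z z1; exists (complex.Re z, complex.Im z) => /=; last by rewrite /f /= [RHS]complexE.
have le1 (x : R) : x ^+ 2 <= complex.Re z ^+ 2 + complex.Im z ^+ 2 -> x \in `[-1, 1].
  move=> xz; rewrite in_itv /= -ler_norml -sqrtr_sqr.
  apply: le_trans (_ : Num.sqrt (complex.Re z ^+ 2 + complex.Im z ^+ 2) <= 1).
    by rewrite ler_wsqrtr.
  by rewrite -lecR -normc_def.
by split; apply: le1; rewrite ?lerDl ?lerDr sqr_ge0.
Unshelve. all: by end_near. Qed.


Variable X : normedModType K.

Definition spans n (e : 'I_n -> X) :=
  forall x : X, exists c : 'I_n -> K, x = \sum_(j < n) c j *: e j.

(** A relation in which [e j] has coefficient [1] expresses [e j] through the
    other vectors, which would then span. *)
Lemma minimal_spans_free n (e : 'I_n -> X) :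
  (forall m (e' : 'I_m -> X), spans e' -> (n <= m)%N) -> spans e ->
  forall (c : 'I_n -> K) j, c j = 1 -> \sum_i c i *: e i != 0.
Proof.
case: n e => [|n] e emin es c j cj1; first by case: j cj1.
apply/eqP => c0; suff /emin : spans (fun i => e (lift j i)) by rewrite ltnn.
have ejE : e j = - \sum_i c (lift j i) *: e (lift j i).
  apply/eqP; rewrite -addr_eq0; apply/eqP; move: c0.
  by rewrite (bigD1_ord j)//= cj1 scale1r.
move=> x; have [a ->] := es x.
exists (fun i => a (lift j i) - a j * c (lift j i)).
rewrite (bigD1_ord j)//= {1}ejE scalerN scaler_sumr addrC -sumrB.
by apply: eq_bigr => i _; rewrite scalerBl scalerA.
Qed.

(** The combinations with [c j = 1] and all other coefficients in a compact set
    containing the disc form a compact set that misses [0]; the general case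
    follows by dividing by the largest coefficient. *)
Lemma coefficient_lower_bound n (e : 'I_n -> X) j :
  (forall c : 'I_n -> K, c j = 1 -> \sum_i c i *: e i != 0) ->
  exists2 r : K, 0 < r & forall c : 'I_n -> K, (forall i, `|c i| <= `|c j|) ->
    r * `|c j| <= `|\sum_i c i *: e i|.
Proof.
move=> ejfree; have [B cB discB] := disc_sub_compact.
pose A i : set K := if i == j then [set 1] else B.
pose PT := prod_topology (fun _ : 'I_n => K).
pose P : set PT := [set c : 'I_n -> K | forall i, A i (c i)].
have cP : compact P.
  apply: tychonoff => i; rewrite /A; case: eqP => // _; exact: compact_set1.
pose comb (c : PT) : X := \sum_i c i *: e i.
have ccomb : continuous comb.
  have cproj i : continuous (fun c : PT => c i).
    exact: (@proj_continuous _ (fun _ : 'I_n => K) i).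
  move=> c.
  apply: (@cvg_sum_ord K X _ (nbhs c) n (fun i c => c i *: e i)
    (fun i => c i *: e i)) => i.
  apply: (@cvgZ K X _ (nbhs c) _ (fun c => c i) (fun=> e i)); last exact: cvg_cst.
  exact: cproj.
have clP : closed (comb @` P).
  apply: compact_closed; first exact: norm_hausdorff.
  by apply: (@continuous_compact PT X comb P) => //; exact: continuous_subspaceT.
have P0 : ~ (comb @` P) 0.
  move=> [c Pc] /eqP; apply/negP; apply: ejfree.
  by have := Pc j; rewrite /A eqxx.
have /nbhs_ballP[r /= r0 rP] : nbhs 0 (~` (comb @` P)).
  by apply: open_nbhs_nbhs; split=> //; exact: closed_openC.
exists r => // c cj; have [cj0|cj0] := eqVneq (c j) 0.
  by rewrite cj0 normr0 mulr0.
have ncj : 0 < `|c j| by rewrite normr_gt0.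
rewrite -ler_pdivlMr// -normrV ?unitfE// mulrC -normrZ.
rewrite real_leNgt ?normr_real ?gtr0_real//.
apply/negP => small; suff /rP : ball 0 r ((c j)^-1 *: \sum_i c i *: e i).
  apply; exists (fun i => (c j)^-1 * c i); last first.
    by rewrite /comb scaler_sumr; apply: eq_bigr => i _; rewrite scalerA.
  move=> i; rewrite /A; case: eqP => [->|_]; first by rewrite mulVf.
  apply: discB; rewrite normrM normfV mulrC ler_pdivrMr// mul1r; exact: cj.
by rewrite -ball_normE /= sub0r normrN.
Qed.

(** A spanning family of least size is free, and [coefficient_lower_bound],
    applied at the coefficient of largest modulus, bounds every coefficient of
    [x] by a multiple of the norm of [x].  This gives both uniqueness, hence
    linearity, and continuity of the coordinates. *)
Lemma continuous_coordinates : finite_dimensional X ->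
  exists n (e : 'I_n -> X) (c : 'I_n -> dual X),
    forall x, x = \sum_j sval (c j) x *: e j.
Proof.
move=> fdX.
have exn : exists n, `[< exists e : 'I_n -> X, spans e >].
  by have [n [e es]] := fdX; exists n; apply/asboolP; exists e.
case: (ex_minnP exn) => n /asboolP[e es] nmin.
have efree := minimal_spans_free _ es.
have {}efree : forall (c : 'I_n -> K) j, c j = 1 -> \sum_i c i *: e i != 0.
  by apply: efree => m e' e's; apply: nmin; apply/asboolP; exists e'.
have [r rP] : {r : 'I_n -> K & forall j, 0 < r j /\
    forall c : 'I_n -> K, (forall i, `|c i| <= `|c j|) ->
      r j * `|c j| <= `|\sum_i c i *: e i|}.
  apply: (@choice _ _ (fun j r => 0 < r /\
    forall c : 'I_n -> K, (forall i, `|c i| <= `|c j|) ->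
      r * `|c j| <= `|\sum_i c i *: e i|)) => j.
  by have [r r0 rj] := coefficient_lower_bound (fun c => efree c j); exists r.
pose M := \sum_j (r j)^-1.
have bound (c : 'I_n -> K) i : `|c i| <= M * `|\sum_i c i *: e i|.
  have [|j _ jmax] := @comparable_arg_maxP _ _ _ i predT (fun i => `|c i|) erefl.
    by move=> *; apply: real_comparable; exact: normr_real.
  have [r0 rj] := rP j; apply: le_trans (jmax i erefl) _.
  apply: le_trans (_ : (r j)^-1 * `|\sum_i c i *: e i| <= _).
    by rewrite mulrC ler_pdivlMr// mulrC; apply: rj => ?; exact: jmax.
  rewrite ler_wpM2r// /M (bigD1 j)//= lerDl sumr_ge0// => l _.
  by rewrite invr_ge0 ltW//; case: (rP l).
have uniq (c d : 'I_n -> K) : \sum_i c i *: e i = \sum_i d i *: e i -> c =1 d.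
  move=> cd i; apply/eqP; rewrite -subr_eq0 -normr_le0.
  have := bound (fun i => c i - d i) i.
  rewrite (eq_bigr (fun i => c i *: e i - d i *: e i)) => [|j _].
    by rewrite sumrB cd subrr normr0 mulr0.
  by rewrite scalerBl.
have [c cE] : {c : X -> 'I_n -> K & forall x, x = \sum_j c x j *: e j}.
  exact: (choice es).
have clin j : linear (fun x => c x j : K^o).
  move=> a x y /=; apply: (uniq _ (fun j => a * c x j + c y j)).
  rewrite -cE {1}(cE x) {1}(cE y) scaler_sumr -big_split /=.
  by apply: eq_bigr => i _; rewrite scalerDl scalerA.
pose C j : {linear X -> K^o} := HB.pack (fun x => c x j : K^o)
  (GRing.isLinear.Build K X K^o *:%R (fun x => c x j : K^o) (clin j)).
have cC j : continuous (C j).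
  apply/linear_bounded_continuous/linear_boundedP.
  near=> N => x; apply: le_trans (_ : M * `|x| <= _).
    by rewrite {2}(cE x); exact: bound.
  rewrite ler_wpM2r//; near: N; apply: nbhs_pinfty_ge.
  by apply: ger0_real; apply: sumr_ge0 => i _; rewrite invr_ge0 ltW//; case: (rP i).
exists n, e, (fun j => exist _ (C j) (cC j)) => x; exact: cE.
Unshelve. all: by end_near. Qed.

Lemma finite_dimensional_weak_cvg (F : set_system X) (x : X) :
  finite_dimensional X -> Filter F -> F --> (x : weak X) -> F --> x.
Proof.
move=> fdX FF /cvg_weakP Fx; have [n [e [c cE]]] := continuous_coordinates fdX.
rewrite (cE x); have -> : F = (fun y => \sum_j sval (c j) y *: e j) @ F.
  rewrite [X in X @ F](_ : _ = id)//.
  by apply/funext => y; rewrite -cE.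
by apply: cvg_sum_ord => j; apply: cvgZr_tmp; exact: Fx.
Qed.

End FiniteDimension.

(** * The weak topology on the unit ball of [C0] is pointwise *)

Section C0WeakTopology.
Variables (R : realType) (k : scalar_kind).
Local Notation K := (scalars R k).
Variables (T : topologicalType) (X : normedModType K).
Implicit Types f g : C0 T X.

(** The filter of pointwise neighbourhoods of [f] in the unit ball converges
    weakly to [f] by [dual_pointwise_small]. *)
Lemma relatively_weakly_open_pointwise (U : set (C0 T X)) f :
  hausdorff_space T -> locally_compact [set: T] -> scattered T ->
  relatively_weakly_open U -> U f ->
  exists (F : seq T) (d : K), 0 < d /\ forall g, `|g| <= 1 ->
    (forall t, t \in F -> `|g t - f t| < d) -> U g.
Proof.
move=> hT lcT scT [V oV ->] [f1 Vf].
pose agree (p : seq T * K) : set (C0 T X) := [set g : C0 T X | `|g| <= 1 /\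
  forall t, t \in p.1 -> `|g t - f t| < p.2].
pose G := filter_from [set p : seq T * K | 0 < p.2] agree.
have GF : Filter G.
  apply: filter_from_filter; first by exists ([::], 1) => /=.
  move=> [F1 d1] [F2 d2] /= d10 d20.
  have d12 : 0 < d1 + d2 by rewrite addr_gt0.
  (* A positive scalar below [d1] and [d2], found without comparing them. *)
  exists (F1 ++ F2, d1 * d2 / (d1 + d2)) => /=; first by rewrite divr_gt0// mulr_gt0.
  move=> g [g1 gd]; split; split=> // t tF.
    apply: lt_trans (gd t _) _; first by rewrite mem_cat tF.
    by rewrite /= ltr_pdivrMr// ltr_pM2l// ltrDr.
  apply: lt_trans (gd t _) _; first by rewrite mem_cat tF orbT.
  by rewrite /= ltr_pdivrMr// mulrC ltr_pM2l// ltrDl.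
have : G --> (f : weak (C0 T X)).
  apply/cvg_weakP => phi; apply/cvgrPdist_lt => e e0.
  have [F [d [d0 Fd]]] := dual_pointwise_small hT lcT scT (svalP phi) e0.
  exists (F, d) => // g [g1 gd] /=; rewrite distrC -linearB; apply: Fd => [|t tF].
    by apply: le_trans (ler_normB _ _) _; rewrite -[2]/(1 + 1) lerD.
  exact: gd.
move=> /(_ V) []; first exact: open_nbhs_nbhs.
by move=> [F d] d0 FV; exists F, d; split=> // g g1 gd; split=> //; apply: FV.
Qed.

(** Composing the evaluation at [t] with a functional of [X] gives a functional
    of [C0], so evaluation is continuous between the weak topologies; on [X] the
    weak topology is that of the norm. *)
Lemma weak_nbhs_eval f (t : T) (d : K) : finite_dimensional X -> 0 < d ->
  nbhs (f : weak (C0 T X)) [set g : C0 T X | `|g t - f t| < d].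
Proof.
move=> fdX d0.
have : (fun g : C0 T X => g t) @ nbhs (f : weak (C0 T X)) --> f t.
  apply: finite_dimensional_weak_cvg => //; apply/cvg_weakP => psi.
  pose evf (g : C0 T X) : K^o := sval psi (g t).
  have evlin : linear evf by move=> a g h; rewrite /evf -linearP.
  pose ev : {linear C0 T X -> K^o} :=
    HB.pack evf (GRing.isLinear.Build K (C0 T X) K^o *:%R evf evlin).
  have cev : continuous ev.
    have /linear_bounded_continuous/linear_boundedP := svalP psi.
    move=> /pinfty_ex_gt0 [M M0 psiM].
    apply/linear_bounded_continuous/linear_boundedP.
    near=> N => g; apply: le_trans (psiM (g t)) _.
    apply: ler_pM => //; first exact: ltW; last exact: C0_norm_at.
    by near: N; apply: nbhs_pinfty_ge; exact: gtr0_real.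
  exact: (@dual_weak_continuous _ _ (exist _ ev cev : dual (C0 T X)) f).
by move=> /cvgrPdist_lt /(_ d d0); apply: filterS => g /=; rewrite distrC.
Unshelve. all: by end_near. Qed.

Lemma weak_nbhs_evals f (F : seq T) (d : T -> K) : finite_dimensional X ->
  (forall t, 0 < d t) ->
  nbhs (f : weak (C0 T X))
    [set g : C0 T X | forall t, t \in F -> `|g t - f t| < d t].
Proof.
move=> fdX d0; elim: F => [|t F ih].
  by apply: filterS (@filterT _ _ (nbhs_filter (f : weak (C0 T X)))).
apply: filterS (filterI (@weak_nbhs_eval f t _ fdX (d0 t)) ih) => g [gt gF] s.
by rewrite inE => /orP[/eqP ->//|]; exact: gF.
Qed.

End C0WeakTopology.

(** * Property (co) at a point *)

Section PropertyCo.
Variables (K : numFieldType) (X : normedModType K).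

(** Move the [xs j] towards [x] by a factor [eta], which makes room to translate
    by [u - x]: the norm is at most [(1 - eta) + eta * `|x| + `|u - x|]. *)
Lemma co_at_interior (x : X) : `|x| < 1 -> co_at x.
Proof.
move=> x1 n _ xs lambda xs1 l0 l1 xE eps eps0.
have e3 : 0 < eps + 3 by rewrite addr_gt0.
(* [3 * eta < eps]: moving towards [x] costs [2 * eta], translating [eta]. *)
pose eta := eps / (eps + 3).
have eta0 : 0 < eta by rewrite divr_gt0.
have eta1 : eta < 1 by rewrite ltr_pdivrMr// mul1r ltrDl.
have etae : 3 * eta < eps.
  by rewrite mulrA ltr_pdivrMr// mulrC ltr_pM2l// ltrDr.
have d0 : 0 < eta * (1 - `|x|) by rewrite mulr_gt0// subr_gt0.
exists (eta * (1 - `|x|)) => // B.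
have normZ (a : K) (y : X) : 0 < a -> `|a *: y| = a * `|y|.
  by move=> a0; rewrite normrZ gtr0_norm.
pose v (j : 'I_n) u := (1 - eta) *: xs j + eta *: x + (u - x).
have Bd u : B u -> `|u - x| <= eta * (1 - `|x|).
  by move=> [+ _]; rewrite -ball_normE /= distrC => /ltW.
exists v; split.
- move=> j; apply: continuous_subspaceT => u; apply: cvgD; first exact: cvg_cst.
  by apply: cvgB; [exact: cvg_id | exact: cvg_cst].
- move=> j u /Bd ux; rewrite /unit_ball /= /v.
  apply: le_trans (ler_normD _ _) _; apply: le_trans (lerD (ler_normD _ _) ux) _.
  have eta1' : 0 < 1 - eta by rewrite subr_gt0.
  rewrite !normZ//.
  rewrite [leRHS](_ : _ = (1 - eta) * 1 + eta * `|x| + eta * (1 - `|x|)); last by ring.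
  by rewrite !lerD2r ler_pM2l//; exact: xs1.
- move=> u _; rewrite /v.
  have -> : \sum_j lambda j *: ((1 - eta) *: xs j + eta *: x + (u - x)) =
      (1 - eta) *: (\sum_j lambda j *: xs j) +
      (\sum_j lambda j) *: (eta *: x + (u - x)).
    rewrite scaler_sumr scaler_suml -big_split /=; apply: eq_bigr => j _.
    by rewrite -addrA scalerDr !scalerA mulrC.
  by rewrite l1 scale1r -xE addrA -scalerDl subrK scale1r addrC subrK.
- move=> j u /Bd ux; rewrite /v.
  rewrite [X in `|X|](_ : _ = eta *: (x - xs j) + (u - x)); last first.
    rewrite scalerBl scale1r scalerBr addrAC; congr (_ + _).
    by rewrite [RHS]addrC addrAC [xs j - _ - _]addrAC subrr add0r.
  apply: le_lt_trans etae; apply: le_trans (ler_normD _ _) _.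
  rewrite normZ//.
  have xxs : `|x - xs j| <= 2.
    apply: le_trans (ler_normB _ _) _; rewrite -[2]/(1 + 1).
    by apply: lerD; [exact: ltW | exact: xs1].
  apply: le_trans (lerD (_ : _ <= eta * 2) ux) _; first by rewrite ler_pM2l.
  rewrite -mulrDr mulrC ler_pM2r// [leRHS](_ : _ = 2 + 1); last by ring.
  by rewrite lerD2l lerBlDr lerDl.
Qed.

(** Property (co) in the form used for gluing, for combinations of any length:
    with a single point the identity is a selection. *)
Lemma co_at_selection (x : X) : co_at x ->
  forall n (xs : 'I_n -> X) (lambda : 'I_n -> K),
    (forall j, `|xs j| <= 1) -> (forall j, 0 < lambda j) ->
    \sum_j lambda j = 1 -> x = \sum_j lambda j *: xs j ->
  forall eps : K, 0 < eps ->
  exists (delta : K) (v : 'I_n -> X -> X), 0 < delta /\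
    let B := ball x delta `&` @unit_ball K X in
      [/\ forall j, {within B, continuous (v j)},
          forall j u, B u -> `|v j u| <= 1,
          forall u, B u -> u = \sum_j lambda j *: v j u
        & forall j u, B u -> `|v j u - xs j| < eps].
Proof.
move=> cox [|[|n]] xs lambda xs1 l0 l1 xE eps eps0.
- by move: l1; rewrite big_ord0 => /esym/eqP; rewrite oner_eq0.
- rewrite big_ord1 in l1; rewrite big_ord1 l1 scale1r in xE.
  exists eps, (fun=> id); split=> // B; split.
  + by move=> j; apply: continuous_subspaceT => u; exact: cvg_id.
  + by move=> j u [].
  + by move=> u _; rewrite big_ord1 l1 scale1r.
  + by move=> j u [+ _]; rewrite -ball_normE /= distrC xE (ord1 j).
have [//|delta delta0 [v vP]] := cox n.+2 _ xs lambda xs1 l0 l1 xE eps eps0.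
by exists delta, v.
Qed.

End PropertyCo.

(** * Gluing pointwise decompositions *)

Lemma common_lower_bound (K : numFieldType) n (d : 'I_n -> K) :
  (forall j, 0 < d j) -> exists2 e, 0 < e & forall j, e <= d j.
Proof.
move=> d0; pose s := \sum_j (d j)^-1.
have s0 : 0 <= s by apply: sumr_ge0 => j _; rewrite invr_ge0 ltW.
have s1 : 0 < 1 + s by rewrite ltr_pwDl.
exists (1 + s)^-1; first by rewrite invr_gt0.
move=> j; rewrite -[leRHS]invrK lef_pV2 ?posrE ?invr_gt0//.
rewrite /s (bigD1 j)//= addrCA lerDl addr_ge0// sumr_ge0// => i _.
by rewrite invr_ge0 ltW.
Qed.

Section Gluing.
Variables (R : realType) (k : scalar_kind).
Local Notation K := (scalars R k).
Variables (T : topologicalType) (X : normedModType K).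
Implicit Types f g : C0 T X.
Hypothesis hausT : hausdorff_space T.
Hypothesis lcT : locally_compact [set: T].
Hypothesis scT : scattered T.
Hypothesis fdX : finite_dimensional X.

(** The points of [F] are treated one after the other, starting from
    [gs j = g]: at a new point [t], the functions [gs j] are replaced by
    [v t j (g s)] on a compact clopen neighbourhood [N] of [t] that avoids the
    points treated before.  The radius [d t] is chosen before [F] and [g], so
    that the sets of functions close to [f] on [F] form weak neighbourhoods. *)
Lemma pointwise_selection n (fs : 'I_n -> C0 T X) (lambda : 'I_n -> K) (eps : K) :
  (forall j, `|fs j| <= 1) -> (forall j, 0 < lambda j) ->
  \sum_j lambda j = 1 -> 0 < eps ->
  (forall t, co_at (\sum_j lambda j *: fs j t)) ->
  exists d : T -> K, (forall t, 0 < d t) /\ forall (F : seq T) g, `|g| <= 1 ->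
    (forall t, t \in F -> `|g t - \sum_j lambda j *: fs j t| < d t) ->
    exists gs : 'I_n -> C0 T X, [/\ forall j, `|gs j| <= 1,
      g = \sum_j lambda j *: gs j &
      forall j t, t \in F -> `|gs j t - fs j t| < eps].
Proof.
move=> fs1 l0 l1 eps0 co_f; pose f t := \sum_j lambda j *: fs j t.
have sel t := co_at_selection (co_f t)
  (fun j => le_trans (C0_norm_at (fs j) t) (fs1 j)) l0 l1 erefl eps0.
have [d dP] := choice sel; have [v vP] := choice dP; exists d.
split=> [t|F g g1 gd]; first by have [] := vP t.
have g1t t : `|g t| <= 1 by exact: le_trans (C0_norm_at _ _) g1.
elim: F gd => [_|t F ih gd].
  exists (fun=> g); split=> //.
  by rewrite -scaler_suml l1 scale1r.
have [|gs [gs1 gE gsF]] := ih; first by move=> s sF; apply: gd; rewrite inE sF orbT.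
have [tF|tF] := boolP (t \in F).
  by exists gs; split=> // j s; rewrite inE => /orP[/eqP ->|]; exact: gsF.
have [_] := vP t; set B := ball _ _ `&` _; move=> [cv v1 vsum veps].
have [N [cN Nt NO]] : exists N, [/\ compact_clopen N, N t &
    N `<=` [set s | `|(g s - f t)| < d t] `&` ~` [set` F]].
  apply: compact_clopen_nbhs => //; apply: filterI; last first.
    apply: open_nbhs_nbhs; split; last exact/negP.
    apply: closed_openC; apply: compact_closed => //.
    by apply: finite_compact; exact: finite_seq.
  have gt : `|g t - f t| < d t by apply: gd; rewrite inE eqxx.
  have : g s - f t @[s --> t] --> g t - f t.
    by apply: cvgB; [exact: C0_continuous | exact: cvg_cst].
  by move=> /cvgr_norm_lt; apply.
have NB s : N s -> B (g s).
  move=> /NO[+ _] /=; rewrite /B -ball_normE /= distrC => near_f.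
  by split=> //; exact: g1t.
have patched j : exists h : C0 T X, forall s,
    h s = patch (gs j) N (fun s => v t j (g s)) s.
  apply: C0_patch => // s; rewrite inE => Ns.
  have /subspace_continuousP /(_ (g s) (NB s Ns)) cvs := cv j.
  move=> A /cvs; rewrite /= /within /= => BA.
  have Ng : nbhs s (g @^-1` [set x | B x -> A (v t j x)]) by exact: C0_continuous.
  apply: filterS (filterI Ng (nbhs_compact_clopen cN Ns)) => r /= [+ Nr].
  by apply; exact: NB.
have [hs hsE] := choice patched.
have hsN j s : N s -> hs j s = v t j (g s).
  by move=> Ns; rewrite hsE /patch ifT// inE.
have hsNC j s : ~ N s -> hs j s = gs j s.
  by move=> Ns; rewrite hsE /patch ifF//; apply/negbTE; rewrite notin_setE.
exists hs; split.
- move=> j; apply: ler_C0_norm => // s; have [Ns|Ns] := pselect (N s).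
    by rewrite hsN//; apply: v1; exact: NB.
  by rewrite hsNC//; exact: le_trans (C0_norm_at _ _) (gs1 j).
- apply: C0_ext => s; rewrite C0_sumE; have [Ns|Ns] := pselect (N s).
    rewrite [LHS](vsum _ (NB s Ns)); apply: eq_bigr => j _.
    by rewrite [RHS](_ : _ = lambda j *: hs j s)// hsN.
  rewrite gE C0_sumE; apply: eq_bigr => j _.
  by rewrite [RHS](_ : _ = lambda j *: hs j s)// hsNC.
- move=> j s; rewrite inE => /orP[/eqP ->|sF].
    by rewrite hsN//; apply: veps; exact: NB.
  by rewrite hsNC ?gsF// => /NO[_]; exact.
Qed.

(** The finite sets and radii describing the [U j] around the [fs j] are merged
    into one finite set [G] and one radius [eps]. *)
Lemma combination_weak_nbhs n (lambda : 'I_n -> K) (U : 'I_n -> set (C0 T X)) f :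
  (forall j, relatively_weakly_open (U j)) -> (forall j, 0 < lambda j) ->
  \sum_j lambda j = 1 -> convex_combination lambda U f ->
  (forall t, co_at (f t)) ->
  exists2 V, nbhs (f : weak (C0 T X)) V &
    forall g, `|g| <= 1 -> V g -> convex_combination lambda U g.
Proof.
move=> oU l0 l1 [fs fsU fE] co_f.
have fs1 j : `|fs j| <= 1.
  by have [V _ UE] := oU j; have := fsU j; rewrite UE => -[].
have sel j := relatively_weakly_open_pointwise hausT lcT scT (oU j) (fsU j).
have [F FP] := choice sel; have [d dP] := choice FP.
have [eps eps0 epsd] := common_lower_bound (fun j => (dP j).1).
have fEt t : f t = \sum_j lambda j *: fs j t by rewrite fE C0_sumE.
have [|r [r0 rP]] := pointwise_selection fs1 l0 l1 eps0.
  by move=> t; rewrite -fEt.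
pose G := flatten [seq F j | j <- enum 'I_n].
have FG j t : t \in F j -> t \in G.
  by move=> tF; apply/flatten_mapP; exists j => //; rewrite mem_enum.
exists [set g : C0 T X | forall t, t \in G -> `|g t - f t| < r t].
  exact: weak_nbhs_evals.
move=> g g1 gG; have [|gs [gs1 gE gsG]] := rP G g g1.
  by move=> t /gG; rewrite fEt.
exists gs => // j; have [_] := dP j; apply=> // t tF.
by apply: lt_le_trans (epsd j); apply: gsG; exact: FG tF.
Qed.

End Gluing.

(** * Convex combinations of weakly open sets *)

Theorem theorem2p5 (R : realType) (k : scalar_kind) (K : topologicalType)
    (X : completeNormedModType (scalars R k)) :
  hausdorff_space K -> locally_compact [set: K]%classic -> scattered K ->
  finite_dimensional X ->
  CWO_B (C0 K X) /\ (property_co X -> CWO (C0 K X)).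
Proof.
move=> hK lcK scK fdX.
have ball_combination n (lambda : 'I_n -> scalars R k) (U : 'I_n -> set (C0 K X)) :
    (forall j, relatively_weakly_open (U j)) -> (forall j, 0 < lambda j) ->
    \sum_j lambda j = 1 ->
    forall f, convex_combination lambda U f -> `|f| <= 1.
  move=> oU l0 l1 f [fs fsU ->]; rewrite -l1; apply: le_trans (ler_norm_sum _ _ _) _.
  apply: ler_sum => j _; rewrite normrZ gtr0_norm// ger_pMr//.
  by have [V _ UE] := oU j; have := fsU j; rewrite UE => -[].
split=> [_ [n [lambda [U [oU l0 l1 ->]]]] f [Cf f1]
  |coX _ [n [lambda [U [oU l0 l1 ->]]]]].
  have [|V fV VC] := combination_weak_nbhs hK lcK scK fdX oU l0 l1 Cf.
    by move=> t; apply: co_at_interior; exact: le_lt_trans (C0_norm_at f t) f1.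
  exists (@unit_ball _ (C0 K X) `&` (V : set (weak (C0 K X)))°); split.
  - by exists (V : set (weak (C0 K X)))° => //; exact: open_interior.
  - by split=> //; exact: ltW.
  - by move=> g [g1 /interior_subset]; exact: VC.
apply: relatively_weakly_open_nbhs => f Cf; first exact: ball_combination Cf.
apply: combination_weak_nbhs => // t; apply: coX.
exact: le_trans (C0_norm_at f t) (ball_combination _ _ _ oU l0 l1 _ Cf).
Qed.
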